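(* Let $S$ be an ordered semigroup. Then the following conditions are equivalent: (1) $S$ is a left $\pi$-$t$-simple ordered semigroup; (2) $S$ is $\pi$-regular and contains an $\mathcal{L}^*$-unique ordered idempotent; (3) $S$ is $\pi$-regular and $a\,\mathcal{L}^*\,b$ for every $a,b\in S$; (4) for every $a,b\in S$ there exists $m\in\mathbb{N}$ such that $a^m\in(a^mSb]$; (5) for every $a,b\in S$ there exists $m\in\mathbb{N}$ such that $a^m\in(a^mSb^n]$ for every $n\in\mathbb{N}$; (6) for every $a,b\in S$ there exists $m\in\mathbb{N}$ such that $a^m\in(a^mSb^m]$; (7) $S$ is $\pi$-regular and $l$-Archimedean; (8) $S$ is a nil-extension of a left simple $\pi$-regular ordered semigroup.
   Context: An ordered semigroup $(S,\cdot,\leq)$ is a (nonempty) semigroup with a partial order such that $a\leq b$ implies $xa\leq xb$ and $ax\leq bx$ for all $a,b,x\in S$. $\mathbb{N}$ denotes the positive integers. For $A\subseteq S$, $(A]=\{x\in S: x\leq a \text{ for some } a\in A\}$. A subsemigroup is regarded as an ordered semigroup with the restricted order. A nonempty $A\subseteq S$ is a left ideal if $SA\subseteq A$ and $(A]=A$, a right ideal if $AS\subseteq A$ and $(A]=A$, and an ideal if it is both. $S$ is left simple if it has no proper left ideal (equivalently $S=(Sa]$ for all $a\in S$). $S$ is $\pi$-regular if for every $a\in S$ there is $m\in\mathbb{N}$ with $a^m\in(a^mSa^m]$. $S$ is $l$-Archimedean (left Archimedean) if for all $a,b\in S$ there is $n\in\mathbb{N}$ with $a^n\in(Sb]$. $S$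 is left $\pi$-$t$-simple if there is a subsemigroup $H$ of $S$ which, as an ordered semigroup, is left simple and $\pi$-regular, such that for every $a\in S$ there is $m\in\mathbb{N}$ with $a^m\in H$. $S$ is a nil-extension of $K$ if $K$ is an ideal of $S$ and for every $a\in S$ there is $m\in\mathbb{N}$ with $a^m\in K$. $L(a)=(\{a\}\cup Sa]$, and $a\,\mathcal{L}\,b$ iff $L(a)=L(b)$. $Reg_\leq(S)=\{a\in S: a\in(aSa]\}$. For $S$ $\pi$-regular, $a\,\mathcal{L}^*\,b$ iff $a^m\,\mathcal{L}\,b^n$, where $m,n$ are the smallest positive integers such that $a^m,b^n\in Reg_\leq(S)$. $E_\leq(S)=\{e\in S: e\leq e^2\}$ is the set of ordered idempotents. $S$ contains an $\mathcal{L}^*$-unique ordered idempotent if there is $e\in E_\leq(S)$ such that $e\,\mathcal{L}^*\,f$ for every $f\in E_\leq(S)$. *)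

(* Defs.v *)
From HB Require Import structures.
From mathcomp Require Import all_boot all_order.
From mathcomp Require Import boolp classical_sets.

Set Implicit Arguments.
Unset Strict Implicit.
Unset Printing Implicit Defensive.

Local Open Scope classical_set_scope.
Local Open Scope group_scope.

HB.mixin Record isOrderedSemigroup (d : Order.disp_t) S
    of Semigroup S & Order.POrder d S := {
  osg_nonempty : inhabited S;
  osg_leM2l : forall x a b : S, (a <= b)%O -> (x * a <= x * b)%O;
  osg_leM2r : forall x a b : S, (a <= b)%O -> (a * x <= b * x)%O
}.

#[short(type="orderedSemigroupType")]
HB.structure Definition OrderedSemigroup (d : Order.disp_t) :=
  { S of isOrderedSemigroup d S & Semigroup S & Order.POrder d S }.

(* The library power natexp needs a unit. This is the product of n copies of
   a when 0 < n; the junk value at n = 0 is a, so every use below carries the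
   hypothesis 0 < n. *)
Definition spow (d : Order.disp_t) (S : orderedSemigroupType d) (a : S)
  (n : nat) : S := iterop n (fun x y : S => x * y) a a.

Notation "a ^^ n" := (spow a n) (at level 29, left associativity).

Record subsemigroup (d : Order.disp_t) (S : orderedSemigroupType d) :=
  Subsemigroup {
    subsg_set :> set S;
    subsg_nonempty : subsg_set !=set0;
    subsg_mul : forall x y, subsg_set x -> subsg_set y -> subsg_set (x * y)
  }.

Section SubOrderedSemigroup.
Context (d : Order.disp_t) (S : orderedSemigroupType d) (H : subsemigroup S).

Definition subsg_type : Type := {x : S | x \in subsg_set H}.

HB.instance Definition _ := SubChoice.on subsg_type.
HB.instance Definition _ :=
  Order.SubChoice_isSubPOrder.Build d S (fun x => x \in subsg_set H) d
    subsg_type.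

Fact subsg_mul_subproof (x y : subsg_type) : val x * val y \in subsg_set H.
Proof. by apply/mem_set/subsg_mul; apply/set_mem/valP. Qed.

Definition subsg_op (x y : subsg_type) : subsg_type :=
  exist _ (val x * val y) (subsg_mul_subproof x y).

Fact subsg_opA : associative subsg_op.
Proof. by move=> x y z; apply/val_inj; rewrite /= mulgA. Qed.

HB.instance Definition _ := isSemigroup.Build subsg_type subsg_opA.

Fact subsg_inhabited : inhabited subsg_type.
Proof. by have [x Hx] := subsg_nonempty H; split; exists x; apply/mem_set. Qed.

Fact subsg_leM2l (x a b : subsg_type) : (a <= b)%O -> (x * a <= x * b)%O.
Proof. exact: osg_leM2l. Qed.

Fact subsg_leM2r (x a b : subsg_type) : (a <= b)%O -> (a * x <= b * x)%O.
Proof. exact: osg_leM2r. Qed.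

HB.instance Definition _ := isOrderedSemigroup.Build d subsg_type
  subsg_inhabited subsg_leM2l subsg_leM2r.

Definition subsg_osg : orderedSemigroupType d := subsg_type.
End SubOrderedSemigroup.

Section Definitions.
Context (d : Order.disp_t) (S : orderedSemigroupType d).
Implicit Types (a b : S) (A : set S).

(* (A] *)
Definition downset A : set S := [set x | exists2 a, A a & (x <= a)%O].

Definition left_ideal A :=
  [/\ A !=set0, [set s * a | s in setT & a in A] `<=` A & downset A = A].

Definition right_ideal A :=
  [/\ A !=set0, [set a * s | a in A & s in setT] `<=` A & downset A = A].

Definition ideal A := left_ideal A /\ right_ideal A.

Definition left_simple := forall A, left_ideal A -> A = setT.

Definition pi_regular := forall a, exists2 m, (0 < m)%N &
  downset [set a ^^ m * s * a ^^ m | s in setT] (a ^^ m).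

Definition l_archimedean := forall a b, exists2 n, (0 < n)%N &
  downset [set s * b | s in setT] (a ^^ n).

(* L(a) *)
Definition lideal_gen a : set S := downset ([set a] `|` [set s * a | s in setT]).

Definition Lrel a b := lideal_gen a = lideal_gen b.

Definition Reg : set S := [set a | downset [set a * s * a | s in setT] a].

Definition regular_index a m :=
  [/\ (0 < m)%N, Reg (a ^^ m)
    & forall k, (0 < k)%N -> Reg (a ^^ k) -> (m <= k)%N].

(* Meant for pi-regular S only, where the indices m and n exist; they are
   always unique. *)
Definition Lstar a b := exists m n,
  [/\ regular_index a m, regular_index b n & Lrel (a ^^ m) (b ^^ n)].

Definition ordered_idempotent : set S := [set e | (e <= e * e)%O].

Definition has_Lstar_unique_ordered_idempotent :=
  exists2 e, ordered_idempotent e &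
    forall f, ordered_idempotent f -> Lstar e f.

Definition nil_extension A :=
  ideal A /\ forall a, exists2 m, (0 < m)%N & A (a ^^ m).

End Definitions.

Arguments left_simple {d} S.
Arguments pi_regular {d} S.
Arguments l_archimedean {d} S.
Arguments has_Lstar_unique_ordered_idempotent {d} S.

Definition left_pi_t_simple (d : Order.disp_t) (S : orderedSemigroupType d) :=
  exists H : subsemigroup S,
    [/\ left_simple (subsg_osg H), pi_regular (subsg_osg H)
      & forall a : S, exists2 m, (0 < m)%N & subsg_set H (a ^^ m)].

(* Main.v *)
(** If a power [c := a ^^ m] satisfies [c <= c * s * c], then [e := s * c] is an
    ordered idempotent with [c] L-related to [e], and [e <= e ^^ n] for all
    [n > 0]; so conditions on powers pass to [e] and, through [c <= c * e],
    back to the regular power [c]. In (7) => (8) the kernel is the intersection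
    of all the left ideals (Sb]: it contains every regular power, and it is a
    right ideal because, for [x] in it and any [s], one may write [x <= t * y]
    with [y] a power of [s] lying in it, so that [x * s <= t * (s * y)]. *)

Require Import Defs.
From mathcomp Require Import all_boot all_order.
From mathcomp Require Import boolp classical_sets.

Import Order.POrderTheory.

Local Open Scope classical_set_scope.
Local Open Scope group_scope.

(** * Powers, ordered idempotents and the relation L *)

Section OrderedSemigroupTheory.
Context {d : Order.disp_t} {S : orderedSemigroupType d}.
Implicit Types (a b c e s x : S) (m n : nat).

Lemma downset_mulP a b x :
  downset [set a * s * b | s in setT] x <-> exists s, (x <= a * s * b)%O.
Proof.
split=> [[_ [s _ <-] le_x]|[s le_x]]; first by exists s.
by exists (a * s * b) => //; exists s.
Qed.

Lemma downset_mulrP b x :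
  downset [set s * b | s in setT] x <-> exists s, (x <= s * b)%O.
Proof.
split=> [[_ [s _ <-] le_x]|[s le_x]]; first by exists s.
by exists (s * b) => //; exists s.
Qed.

Lemma spowS a n : (0 < n)%N -> a ^^ n.+1 = a * a ^^ n.
Proof. by case: n. Qed.

Lemma spowD a m n : (0 < m)%N -> (0 < n)%N -> a ^^ (m + n) = a ^^ m * a ^^ n.
Proof.
case: m => // m _ n_gt0; elim: m => [|m IHm]; first by rewrite add1n spowS.
by rewrite addSn spowS // IHm [in RHS]spowS // mulgA.
Qed.

Lemma spowSr a n : (0 < n)%N -> a ^^ n.+1 = a ^^ n * a.
Proof. by move=> n_gt0; rewrite -addn1 spowD. Qed.

Lemma spowM a m n : (0 < m)%N -> (0 < n)%N -> a ^^ (m * n) = a ^^ m ^^ n.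
Proof.
move=> m_gt0; case: n => // n _; elim: n => [|n IHn]; first by rewrite muln1.
by rewrite mulnS spowD ?muln_gt0 ?m_gt0 // IHn [in RHS]spowS.
Qed.

(** All but the last factor of [b ^^ n] can be absorbed into the middle element. This turns bounds
    by powers of [b] into bounds by [b] itself. *)
Lemma le_mul_spow a b x s n : (0 < n)%N -> (x <= a * s * b ^^ n)%O ->
  exists t, (x <= a * t * b)%O.
Proof.
case: n => [//|[|n]] _ le_x; first by exists s.
by exists (s * b ^^ n.+1); rewrite -mulgA -mulgA -spowSr // mulgA.
Qed.

Lemma le_mulr_spow x c n : (0 < n)%N -> (x <= x * c)%O -> (x <= x * c ^^ n)%O.
Proof.
case: n => // n _ le_x; elim: n => // n IHn.
by rewrite spowS // mulgA; apply: le_trans IHn (osg_leM2r _ _ _ le_x).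
Qed.

Lemma ordered_idempotent_le_spow e n :
  (0 < n)%N -> ordered_idempotent e -> (e <= e ^^ n)%O.
Proof.
case: n => // n _ le_e; elim: n => // n IHn.
by rewrite spowS //; apply: le_trans le_e (osg_leM2l _ _ _ IHn).
Qed.

Lemma ordered_idempotent_Reg e : ordered_idempotent e -> Reg e.
Proof.
move=> le_e; apply/downset_mulP; exists e.
by apply: le_trans le_e (osg_leM2r _ _ _ le_e).
Qed.

Lemma ordered_idempotent_regular_index e :
  ordered_idempotent e -> regular_index e 1.
(* [e ^^ 1] computes to [e], and minimality of the index 1 is just [0 < k]. *)
Proof. by move/ordered_idempotent_Reg. Qed.

Lemma regular_index_uniq a m n :
  regular_index a m -> regular_index a n -> m = n.
Proof.
move=> [m_gt0 am mmin] [n_gt0 an nmin].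
by apply/eqP; rewrite eqn_leq mmin ?nmin.
Qed.

Lemma ordered_idempotent_mul_regular a s :
  (a <= a * s * a)%O -> ordered_idempotent (s * a).
Proof.
move=> le_a; have := osg_leM2l s _ _ le_a.
by rewrite /ordered_idempotent /= !mulgA.
Qed.

Lemma lideal_genP a x :
  lideal_gen a x <-> (x <= a)%O \/ exists s, (x <= s * a)%O.
Proof.
split=> [[y [->|[s _ <-]] le_x]|[le_x|[s le_x]]].
- by left.
- by right; exists s.
- by exists a => //; left.
- by exists (s * a) => //; right; exists s.
Qed.

Lemma lideal_gen_sub a b : lideal_gen b a -> lideal_gen a `<=` lideal_gen b.
Proof.
move=> /lideal_genP Lba x /lideal_genP Lax; apply/lideal_genP.
case: Lax => [le_xa|[s le_xa]]; case: Lba => [le_ab|[t le_ab]].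
- by left; apply: le_trans le_ab.
- by right; exists t; apply: le_trans le_ab.
- by right; exists s; apply: le_trans le_xa (osg_leM2l _ _ _ le_ab).
- right; exists (s * t); rewrite -mulgA.
  exact: le_trans le_xa (osg_leM2l _ _ _ le_ab).
Qed.

Lemma LrelP a b : lideal_gen b a -> lideal_gen a b -> Lrel a b.
Proof. by move=> ba ab; apply/seteqP; split; apply: lideal_gen_sub. Qed.

Lemma Lrel_lideal_gen a b : Lrel a b -> lideal_gen b a.
Proof. by move=> <-; apply/lideal_genP; left. Qed.

Lemma Reg_Lrel_ordered_idempotent a :
  Reg a -> exists2 e, ordered_idempotent e & Lrel a e.
Proof.
case/downset_mulP=> s le_a; exists (s * a).
  exact: ordered_idempotent_mul_regular.
apply: LrelP; apply/lideal_genP; right; last by exists s.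
by exists a; rewrite mulgA.
Qed.

Lemma pi_regular_Reg a : pi_regular S -> exists2 m, (0 < m)%N & Reg (a ^^ m).
Proof. by move=> /(_ a). Qed.

Lemma pi_regular_index a : pi_regular S -> exists m, regular_index a m.
Proof.
move=> /(pi_regular_Reg a)[m m_gt0 am].
(* The classical boolean reflection of [Reg] allows a least exponent to be chosen. *)
have exP : exists n, (0 < n)%N && `[< Reg (a ^^ n) >].
  by exists m; rewrite m_gt0; apply/asboolP.
case: (ex_minnP exP) => n /andP[n_gt0 /asboolP an] nmin.
by exists n; split=> // k k_gt0 ak; apply: nmin; rewrite k_gt0; apply/asboolP.
Qed.

Lemma pi_regular_ordered_idempotent :
  pi_regular S -> exists e, ordered_idempotent e.
Proof.
have [a] := @osg_nonempty _ S => /(pi_regular_Reg a)[m _].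
by case/Reg_Lrel_ordered_idempotent => e; exists e.
Qed.

End OrderedSemigroupTheory.

(** * Transfer between a subsemigroup and the whole semigroup *)

Section SubsemigroupTheory.
Context {d : Order.disp_t} {S : orderedSemigroupType d} (H : subsemigroup S).

Lemma val_spow (x : subsg_osg H) n : (0 < n)%N ->
  val (x ^^ n : subsg_osg H) = (val x : S) ^^ n.
Proof.
case: n => // n _; elim: n => // n IHn.
by rewrite [RHS]spowS // -IHn spowS.
Qed.

(** The downset of [H * b], taken inside [H], is a left ideal of [H], hence all of [H]. *)
Lemma left_simple_le (a b : S) : left_simple (subsg_osg H) ->
  subsg_set H a -> subsg_set H b -> exists2 h, subsg_set H h & (a <= h * b)%O.
Proof.
move=> simpleH Ha Hb.
pose b' : subsg_osg H := exist _ b (mem_set Hb).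
pose a' : subsg_osg H := exist _ a (mem_set Ha).
have ideal_b : left_ideal (downset [set s * b' | s in setT]).
  split.
  - by exists (b' * b'); apply/downset_mulrP; exists b'.
  - move=> _ [s _ [x /downset_mulrP[t le_x] <-]]; apply/downset_mulrP.
    by exists (s * t); rewrite -mulgA; apply: osg_leM2l.
  - apply/seteqP; split=> [x [y /downset_mulrP[s le_y] le_x]|x bx].
      by apply/downset_mulrP; exists s; apply: le_trans le_y.
    by exists x.
have : downset [set s * b' | s in setT] a' by rewrite (simpleH _ ideal_b).
by case/downset_mulrP=> h le_a; exists (val h) => //; apply/set_mem/valP.
Qed.

(** A regular power in [H] of [a ^^ m] is again a power of [a], with exponent [m * n]. *)
Lemma pi_regular_of_sub : pi_regular (subsg_osg H) ->
  (forall a : S, exists2 m, (0 < m)%N & subsg_set H (a ^^ m)) -> pi_regular S.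
Proof.
move=> regH powH a; have [m m_gt0 Ham] := powH a.
pose a' : subsg_osg H := exist _ (a ^^ m) (mem_set Ham).
have [n n_gt0 /downset_mulP[h le_an]] := regH a'.
exists (m * n)%N; first by rewrite muln_gt0 m_gt0.
apply/downset_mulP; exists (val h); rewrite spowM // -[a ^^ m]/(val a').
by rewrite -val_spow.
Qed.

(** Left simplicity compares the powers [a ^^ m] and [b ^^ n] that lie in [H]; the element [a]
    itself is reached through [a <= a ^^ m.+1 = a * a ^^ m]. *)
Lemma ordered_idempotent_le_mul (a b : S) :
  left_simple (subsg_osg H) ->
  (forall a : S, exists2 m, (0 < m)%N & subsg_set H (a ^^ m)) ->
  ordered_idempotent a -> exists s, (a <= s * b)%O.
Proof.
move=> simpleH powH ida.
have [m m_gt0 Ham] := powH a; have [n n_gt0 Hbn] := powH b.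
have [h _ le_am] := left_simple_le _ _ simpleH Ham Hbn.
have [|t le_t] := @le_mul_spow _ _ a b (a * a ^^ m) h _ n_gt0.
  by rewrite -mulgA; apply: osg_leM2l.
exists (a * t); apply: le_trans le_t.
by rewrite -spowS //; apply: ordered_idempotent_le_spow.
Qed.

End SubsemigroupTheory.

(** * The left simple kernel of a pi-regular l-Archimedean semigroup *)

Section Kernel.
Context {d : Order.disp_t} {S : orderedSemigroupType d}.
Context (regS : pi_regular S) (archS : l_archimedean S).

Definition left_kernel : set S := [set x | forall b, exists s, (x <= s * b)%O].

(** With [e := s * a] and [e ^^ n <= t * b], one has [a <= a * e <= a * e ^^ n <= a * t * b]. *)
Lemma Reg_left_kernel (a : S) : Reg a -> left_kernel a.
Proof.
case/downset_mulP=> s le_a b.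
have ide := ordered_idempotent_mul_regular _ _ le_a.
have [n n_gt0 /downset_mulrP[t le_en]] := archS (s * a) b.
exists (a * t); rewrite -mulgA; apply: le_trans (osg_leM2l _ _ _ le_en).
apply: le_trans le_a _; rewrite -mulgA.
by apply: osg_leM2l; apply: ordered_idempotent_le_spow.
Qed.

Lemma left_kernel_mull (s x : S) : left_kernel x -> left_kernel (s * x).
Proof.
by move=> Kx b; have [t le_x] := Kx b; exists (s * t); rewrite -mulgA osg_leM2l.
Qed.

Lemma left_kernel_le (x y : S) : (x <= y)%O -> left_kernel y -> left_kernel x.
Proof.
by move=> le_xy Ky b; have [t le_y] := Ky b; exists t; apply: le_trans le_y.
Qed.

Lemma left_kernel_spow (a : S) : exists2 m, (0 < m)%N & left_kernel (a ^^ m).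
Proof.
have [m m_gt0 am] := pi_regular_Reg a regS.
by exists m => //; apply: Reg_left_kernel.
Qed.

Lemma left_kernel_mulr (x s : S) : left_kernel x -> left_kernel (x * s).
Proof.
move=> Kx; have [m m_gt0 Ksm] := left_kernel_spow s.
have [t le_x] := Kx (s ^^ m).
apply: left_kernel_le (osg_leM2r _ _ _ le_x) _.
rewrite -mulgA -spowSr // spowS //.
by do 2!apply: left_kernel_mull.
Qed.

Lemma left_kernel_nonempty : left_kernel !=set0.
Proof.
have [a] := @osg_nonempty _ S.
by have [m _ Kam] := left_kernel_spow a; exists (a ^^ m).
Qed.

Definition left_kernel_subsemigroup : subsemigroup S :=
  @Subsemigroup _ S left_kernel left_kernel_nonempty
    (fun x y _ => @left_kernel_mull x y).

Local Notation K := left_kernel_subsemigroup.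

Lemma left_kernel_simple : left_simple (subsg_osg K).
Proof.
move=> A [[a Aa] KA downA]; apply/seteqP; split=> // x _.
have Kx : left_kernel (val x) by apply/set_mem/valP.
have Ka : left_kernel (val a) by apply/set_mem/valP.
(* Bounding by [a * a] rather than [a] makes the left multiplier [s * a] an element of the kernel,
   as an ideal of the subsemigroup requires. *)
have [s le_x] := Kx (val a * val a).
pose sa : subsg_osg K :=
  exist _ (s * val a) (mem_set (left_kernel_mull s _ Ka)).
rewrite -downA; exists (sa * a); first by apply: KA; exists sa => //; exists a.
by move: le_x; rewrite mulgA.
Qed.

Lemma left_kernel_pi_regular : pi_regular (subsg_osg K).
Proof.
move=> x; have [m m_gt0 /downset_mulP[s le_xm]] := regS (val x).
exists m => //; apply/downset_mulP.
have Kxm : left_kernel (val x ^^ m).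
  by rewrite -val_spow //; apply/set_mem/valP.
(* The element [s] may lie outside the kernel. Substituting the regularity inequality into its own
   leftmost factor replaces [s] by [s * x ^^ m * s], which lies inside. *)
have Kt : left_kernel (s * val x ^^ m * s).
  by apply/left_kernel_mulr/left_kernel_mull.
exists (exist _ (s * val x ^^ m * s) (mem_set Kt)).
rewrite -[(_ <= _)%O]/(val (x ^^ m : subsg_osg K) <=
  val (x ^^ m : subsg_osg K) * _ * val (x ^^ m : subsg_osg K))%O val_spow //=.
apply: le_trans (le_xm) _; rewrite !mulgA.
by do 2!apply: osg_leM2r; exact: le_xm.
Qed.

Lemma left_kernel_nil_extension : nil_extension (subsg_set K).
Proof.
have downK : downset left_kernel = left_kernel.
  apply/seteqP; split=> [x [y Ky le_x]|x Kx]; last by exists x.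
  exact: left_kernel_le Ky.
split; last exact: left_kernel_spow.
split; split=> //; try exact: left_kernel_nonempty.
  by move=> _ [s _ [x Kx <-]]; apply: left_kernel_mull.
by move=> _ [x Kx [s _ <-]]; apply: left_kernel_mulr.
Qed.

End Kernel.

(** * The cycle of implications *)

Theorem theorem2p3 (d : Order.disp_t) (S : orderedSemigroupType d) :
  [<-> (* 1 *) left_pi_t_simple S;
       (* 2 *) pi_regular S /\ has_Lstar_unique_ordered_idempotent S;
       (* 3 *) pi_regular S /\ (forall a b : S, Lstar a b);
       (* 4 *) forall a b : S, exists2 m, (0 < m)%N &
                 downset [set a ^^ m * s * b | s in setT] (a ^^ m);
       (* 5 *) forall a b : S, exists2 m, (0 < m)%N &
                 forall n, (0 < n)%N ->
                   downset [set a ^^ m * s * b ^^ n | s in setT] (a ^^ m);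
       (* 6 *) forall a b : S, exists2 m, (0 < m)%N &
                 downset [set a ^^ m * s * b ^^ m | s in setT] (a ^^ m);
       (* 7 *) pi_regular S /\ l_archimedean S;
       (* 8 *) exists K : subsemigroup S,
                 [/\ left_simple (subsg_osg K), pi_regular (subsg_osg K)
                   & nil_extension (subsg_set K)]].
Proof.
tfae.
- move=> [H [simpleH regH powH]].
  have regS := pi_regular_of_sub H regH powH; split=> //.
  have [e ide] := pi_regular_ordered_idempotent regS.
  exists e => // f idf; exists 1%N, 1%N; split.
  + exact: ordered_idempotent_regular_index.
  + exact: ordered_idempotent_regular_index.
  by apply: LrelP; apply/lideal_genP; right;
    apply: (ordered_idempotent_le_mul H _ _ simpleH powH).
- move=> [regS [e ide uniq_e]]; split=> // a b.
  (* The regular power [c ^^ m] is L-related to an ordered idempotent [f], and [f] to [e] because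
     both have index 1. So all these powers share one L-class. *)
  have Le c m : regular_index c m -> Lrel (c ^^ m) e.
    case=> m_gt0 /Reg_Lrel_ordered_idempotent[f idf Lcf] _.
    have [i [j [ei fj Lef]]] := uniq_e f idf; rewrite /Lrel Lcf.
    have -> : e = e ^^ i.
      have e1 := ordered_idempotent_regular_index _ ide.
      by rewrite (regular_index_uniq _ _ _ ei e1).
    have f1 := ordered_idempotent_regular_index _ idf.
    by rewrite Lef (regular_index_uniq _ _ _ fj f1).
  have [m am] := pi_regular_index a regS.
  have [n bn] := pi_regular_index b regS.
  by exists m, n; split=> //; rewrite /Lrel (Le a) // (Le b).
- move=> [_ LS] a b.
  have [m [n [[m_gt0 /downset_mulP[s le_am] _] [n_gt0 _ _] Lab]]] := LS a b.
  exists m => //; apply/downset_mulP.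
  (* The bound of [a ^^ m] by [b ^^ n] or [t * b ^^ n] is substituted for the right factor of
     [a ^^ m * s * a ^^ m]. *)
  case/Lrel_lideal_gen/lideal_genP: Lab => [le_ab|[t le_ab]].
    apply: (le_mul_spow _ _ _ s n n_gt0).
    exact: le_trans le_am (osg_leM2l _ _ _ le_ab).
  apply: (le_mul_spow _ _ _ (s * t) n n_gt0).
  rewrite (mulgA (a ^^ m)) -(mulgA _ t).
  exact: le_trans le_am (osg_leM2l _ _ _ le_ab).
- move=> h a b; have [m m_gt0 /downset_mulP[s le_am]] := h a b.
  exists m => // n n_gt0; apply/downset_mulP.
  (* (4) applied to [s * b] lets the same [m] serve every right factor. *)
  have [k k_gt0 /downset_mulP[t le_sbk]] := h (s * b) (b ^^ n).
  have le_amk : (a ^^ m <= a ^^ m * (s * b) ^^ k)%O.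
    by apply: le_mulr_spow => //; rewrite mulgA.
  exists ((s * b) ^^ k * t); apply: le_trans le_amk _.
  by rewrite -mulgA; apply: osg_leM2l.
- by move=> h a b; have [m m_gt0 hm] := h a b; exists m => //; apply: hm.
(* Taking [b := a] gives pi-regularity; for the l-Archimedean property, [a ^^ m] joins the left
   multiplier. *)
- move=> h; split=> [a|a b]; first exact: (h a a).
  have [m m_gt0 /downset_mulP[s le_am]] := h a b.
  exists m => //; apply/downset_mulrP.
  have [t le_t] := le_mul_spow _ _ _ _ _ m_gt0 le_am.
  by exists (a ^^ m * t).
- move=> [regS archS]; exists (left_kernel_subsemigroup regS archS); split.
  + exact: left_kernel_simple.
  + exact: left_kernel_pi_regular.
  + exact: left_kernel_nil_extension.
- by move=> [K [simpleK regK [_ powK]]]; exists K.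
Qed.
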